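(* There is a universal constant $C>0$ such that the following holds. Let $\alpha\in(0,1)$, $B>0$, let $P$ be a probability measure on a measurable space $(\Omega,\mathcal F)$, let $X:\Omega\to[-B,B]$ be measurable, and let $\mathcal R(X)=\mathrm{CVaR}_\alpha(X)$. For any $\delta\in(0,1)$ and $\epsilon\in(0,B]$, we have $|\mathcal R(X)-\mathcal R_n(X)|\le\epsilon$ with probability at least $1-\delta$ whenever $$n\ge C\,\Lambda^{C}\Big(\frac{B^2}{\alpha\epsilon^2}+\frac{B}{\alpha\epsilon}\Big),\qquad \Lambda=\log\Big(e+B+\frac1B+\frac1\epsilon+\frac1\alpha+\frac1\delta\Big);$$ that is, the number of samples needed is bounded by $\tilde{O}\big(\frac{B^2}{\alpha\epsilon^2}+\frac{B}{\alpha\epsilon}\big)$.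
   Context: For a probability measure $P$, the conditional value-at-risk is $$\mathrm{CVaR}_\alpha(X)=\mathcal R^P(X)=\sup\Big\{\int_\Omega X\zeta\,dP:\ \zeta \text{ measurable},\ 0\le\zeta\le 1/\alpha\ P\text{-a.s.},\ \int_\Omega\zeta\,dP=1\Big\}.$$ (This is the distributionally robust functional of the divergence function $\phi$ equal to $0$ on $[0,1/\alpha]$ and $+\infty$ elsewhere.) $P_n$ is the empirical distribution of $n$ i.i.d. samples from $P$, and $\mathcal R_n(X)=\mathcal R^{P_n}(X)$ is the same quantity with $P$ replaced by $P_n$. *)

(* Defs.v *)
From HB Require Import structures.
From mathcomp Require Import all_boot all_order all_algebra.
From mathcomp Require Import all_classical all_reals all_analysis.
Import Order.TTheory GRing.Theory Num.Theory.
Import numFieldNormedType.Exports.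

Set Implicit Arguments.
Unset Strict Implicit.
Unset Printing Implicit Defensive.

Local Open Scope classical_set_scope.
Local Open Scope ring_scope.

(* [P] is a bare measure so that [cvar] applies directly to [empirical];
   it is meant for measures of total mass 1. For bounded [X] the supremum is
   then a finite number; it is kept in [\bar R] to avoid junk values. *)
Definition cvar d (T : measurableType d) (R : realType)
    (P : {measure set T -> \bar R}) (alpha : R) (X : T -> R) : \bar R :=
  ereal_sup [set (\int[P]_w (X w * zeta w)%:E)%E | zeta in
    [set zeta : T -> R | [/\ measurable_fun setT zeta,
      {ae P, forall w, 0 <= zeta w <= alpha^-1} &
      (\int[P]_w (zeta w)%:E = 1)%E]]].

Section empirical.
Local Open Scope ereal_scope.
Context d (T : measurableType d) (R : realType).

(* For [n = 0] this is the zero measure, since [0^-1 = 0]. *)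
Definition empirical (n : nat) (s : 'I_n -> T) (A : set T) : \bar R :=
  (n%:R^-1)%:E * \sum_(i < n) \d_(s i) A.

Variables (n : nat) (s : 'I_n -> T).

Let sum_dirac_ge0 A : 0 <= \sum_(i < n) \d_(s i) A :> \bar R.
Proof. by apply: sume_ge0 => i _. Qed.

Let empirical0 : empirical s set0 = 0.
Proof. by rewrite /empirical big1 ?mule0// => i _; rewrite measure0. Qed.

Let empirical_ge0 A : 0 <= empirical s A.
Proof. by rewrite /empirical mule_ge0// lee_fin invr_ge0. Qed.

Let empirical_sigma_additive : semi_sigma_additive (empirical s).
Proof.
move=> F mF tF mUF; rewrite /empirical.
rewrite [X in X @ \oo --> _](_ : _ = (fun k => (n%:R^-1)%:E *
    \sum_(0 <= j < k) \sum_(i < n) \d_(s i) (F j))); last first.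
  by apply/funext => k; rewrite ge0_sume_distrr.
apply: cvgeZl => //.
rewrite [X in _ --> X](_ : _ =
    lim ((fun k => \sum_(0 <= j < k) \sum_(i < n) \d_(s i) (F j)) @ \oo)).
  by apply: is_cvg_ereal_nneg_natsum => k _; exact: sume_ge0.
rewrite nneseries_sum//; apply: eq_bigr => /= i _.
exact: measure_semi_bigcup.
Qed.

HB.instance Definition _ := isMeasure.Build _ _ _ (empirical s)
  empirical0 empirical_ge0 empirical_sigma_additive.

Lemma empirical_setT : (0 < n)%N -> empirical s setT = 1.
Proof.
move=> n0; rewrite /empirical (eq_bigr (fun=> (1%R : R)%:E)); last first.
  by move=> i _; rewrite diracT.
by rewrite sumEFin sumr_const card_ord -EFinM mulVf// pnatr_eq0 -lt0n.
Qed.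

End empirical.

Definition mutually_independent d d' (T : measurableType d)
    (T' : measurableType d') (R : realType) (Q : probability T R)
    (n : nat) (S : 'I_n -> T -> T') : Prop :=
  forall (J : {set 'I_n}) (A : 'I_n -> set T'),
    (forall i, measurable (A i)) ->
    (Q (\bigcap_(i in [set` J]) (S i @^-1` A i))
       = \prod_(i in J) Q (S i @^-1` A i))%E.

Definition iid_samples d d' (T : measurableType d) (T' : measurableType d')
    (R : realType) (Q : probability T R) (P : probability T' R)
    (n : nat) (S : 'I_n -> T -> T') : Prop :=
  [/\ forall i, measurable_fun setT (S i),
      forall i A, measurable A -> Q (S i @^-1` A) = P A &
      mutually_independent Q S].

(* Measurability of the event is part of the claim: outside the sigma-algebra
   the values of [Q] are unconstrained. *)
Definition holds_with_probability_ge d (T : measurableType d) (R : realType)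
    (Q : probability T R) (p : R) (E : set T) : Prop :=
  measurable E /\ (p%:E <= Q E)%E.

(* Main.v *)
(* With f(c) = c + E(X - c)_+ / alpha, weak duality gives CVaR <= f(c) for all c,
   with equality at the quantile c0: there the density zeta equal to 1 / alpha
   above c0 and 0 below it satisfies zeta (X - c0) = (X - c0)_+ / alpha. The
   same holds for the empirical measure, with objective f_n.
   Upper bound: CVaR_n <= f_n(c0), an average of n copies of zeta (X - c0).
   Lower bound: f_n(c) >= c + mean zeta (X - c), which is affine in c, so only
   c = B and c = - B matter. No union bound over c is needed: the three
   averages involved are of the form zeta (X - b), bounded by 2 B / alpha and of
   second moment at most 4 B^2 / alpha because 0 <= zeta <= 1 / alpha and
   E zeta = 1. A Bernstein-type Chernoff bound, using exp x <= 1 + x + x^2,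
   bounds each deviation probability by exp(- n alpha epsilon^2 / (16 B^2)). *)

Require Import Defs.
From mathcomp Require Import all_boot all_order all_algebra.
From mathcomp Require Import all_classical all_reals all_analysis.
From mathcomp Require Import measurable_realfun lra ring.
Import Order.TTheory GRing.Theory Num.Theory.
Import numFieldNormedType.Exports.

Set Implicit Arguments.
Unset Strict Implicit.
Unset Printing Implicit Defensive.

Local Open Scope classical_set_scope.
Local Open Scope ring_scope.

(** * Quantiles of a bounded random variable *)

Lemma measurable_superlevel d (T : measurableType d) (R : realType)
    (X : T -> R) (c : R) : measurable_fun setT X ->
  measurable [set w | (c <= X w)%R] /\ measurable [set w | (c < X w)%R].
Proof.
move=> mX; split.
- have := mX measurableT `[c, +oo[%classic (measurable_itv _).
  by rewrite setTI; congr measurable; apply/seteqP; split=> w /=;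
    rewrite in_itv/= andbT.
- have := mX measurableT `]c, +oo[%classic (measurable_itv _).
  by rewrite setTI; congr measurable; apply/seteqP; split=> w /=;
    rewrite in_itv/= andbT.
Qed.

(** The witness is the supremum of the levels [c] with [P (X >= c) >= a]. Both inequalities at the
    supremum come from continuity of the measure, so atoms at the quantile are allowed. *)
Lemma quantile_exists d (T : measurableType d) (R : realType)
    (P : {measure set T -> \bar R}) (X : T -> R) (B a : R) :
  P setT = 1%E -> measurable_fun setT X -> (forall w, - B <= X w <= B) ->
  0 < a -> a <= 1 ->
  exists c : R, [/\ - B <= c <= B, (P [set w | (c < X w)%R] <= a%:E)%E &
                (a%:E <= P [set w | (c <= X w)%R])%E].
Proof.
move=> P1 mX XB a0 a1.
have mge (c : R) := (measurable_superlevel c mX).1.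
pose D := [set c : R | (a%:E <= P [set w | (c <= X w)%R])%E].
have DB : D (- B).
  rewrite /D /=; have -> : [set w | - B <= X w] = setT.
    by apply/seteqP; split=> // w _ /=; case/andP: (XB w).
  by rewrite P1 lee_fin.
have ubD : ubound D B.
  move=> c; rewrite /D /= => Pc; rewrite leNgt; apply/negP => Bc.
  move: Pc; have -> : [set w | (c <= X w)%R] = set0.
    apply/seteqP; split=> // w /= cX; have /andP[_ XwB] := XB w.
    by have := le_lt_trans (le_trans cX XwB) Bc; rewrite ltxx.
  by rewrite measure0 lee_fin leNgt a0.
have supD : has_sup D by split; [exists (- B) | exists B].
have downD c : c < sup D -> D c.
  rewrite -subr_gt0 => /sup_adherent/(_ supD)[e De]; rewrite subKr => ce.
  apply: le_trans De _; apply: le_measure; rewrite ?inE// => w /=.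
  exact/le_trans/ltW.
exists (sup D); split.
- by rewrite ub_le_sup ?ge_sup//=; [exists (- B) | exists B].
(* From below: every level [sup D + 1 / (k + 1)] lies outside [D], so each set of the increasing
   union has mass less than [a]. *)
- have -> : [set w | sup D < X w] =
      \bigcup_k [set w | sup D + k.+1%:R^-1 <= X w].
    apply/seteqP; split=> [w /= sX|w [k _ /=]]; last first.
      by apply: lt_le_trans; rewrite ltrDl.
    have [k kX] := ltr_add_invr sX.
    by exists k => //=; apply: ltW.
  have nd : nondecreasing_seq (fun k => [set w | sup D + k.+1%:R^-1 <= X w]).
    move=> m n mn; apply/subsetPset => w /=; apply: le_trans.
    by rewrite lerD2l lef_pV2 ?posrE// ler_nat ltnS.
  have cv := nondecreasing_cvg_mu (mu := P) (fun k => mge _)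
    (bigcup_measurable (fun k _ => mge _)) nd.
  rewrite -(cvg_lim _ cv)//; apply: lime_le; first by apply/cvg_ex; eexists; exact: cv.
  apply: nearW => k /=; apply: ltW; rewrite ltNge; apply/negP => Dk.
  have := sup_ubound supD.2 Dk.
  by rewrite leNgt ltrDl invr_gt0 ltr0n.
(* From above: every level [sup D - 1 / (k + 1)] lies in [D], so each set of the decreasing
   intersection has mass at least [a]. *)
- have -> : [set w | sup D <= X w] =
      \bigcap_k [set w | sup D - k.+1%:R^-1 <= X w].
    apply/seteqP; split=> [w /= sX k _ /=|w /= H].
      by apply: le_trans sX; rewrite gerBl.
    rewrite leNgt; apply/negP => /ltr_add_invr[k].
    by have /= := H k I; rewrite lerBlDr => /le_lt_trans/[apply]; rewrite ltxx.
  have ni : nonincreasing_seq (fun k => [set w | sup D - k.+1%:R^-1 <= X w]).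
    move=> m n mn; apply/subsetPset => w /=; apply: le_trans.
    by rewrite lerD2l lerN2 lef_pV2 ?posrE// ler_nat ltnS.
  have P0 : (P [set w | sup D - 0.+1%:R^-1 <= X w]%R < +oo)%E.
    apply: (@le_lt_trans _ _ (P setT)); last by rewrite P1 ltry.
    by apply: le_measure; rewrite ?inE//; exact: mge.
  have cv := nonincreasing_cvg_mu P0 (fun k => mge _)
    (bigcap_measurable (ex_intro _ 0%N I) (fun k _ => mge _)) ni.
  rewrite -(cvg_lim _ cv)//; apply: lime_ge; first by apply/cvg_ex; eexists; exact: cv.
  by apply: nearW => k /=; apply: downD; rewrite gtrBl.
Qed.

(** * Bounds and integrability for bounded functions *)

Lemma bounded_integrable d (T : measurableType d) (R : realType)
    (P : {measure set T -> \bar R}) (f : T -> R) (M : R) :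
  P setT = 1%E -> measurable_fun setT f -> (forall w, `|f w| <= M) ->
  P.-integrable setT (EFin \o f).
Proof.
move=> P1 mf fM; apply: measurable_bounded_integrable => //.
  by rewrite P1 ltry.
by exists M; split=> [|x Mx w _]; [exact: num_real | exact/(le_trans (fM w))/ltW].
Qed.

Lemma Rintegral_indic d (T : measurableType d) (R : realType)
    (P : {measure set T -> \bar R}) (A : set T) :
  measurable A -> \int[P]_w (\1_A w) = fine (P A).
Proof. by move=> mA; rewrite /Rintegral integral_indic// setIT. Qed.

Lemma norm_density_mul (R : realType) (z x a M : R) :
  0 <= z <= a^-1 -> `|x| <= M -> `|x * z| <= M / a.
Proof. by move=> /andP[z0 za] xM; rewrite normrM (ger0_norm z0) ler_pM. Qed.

Lemma norm_density_shift (R : realType) (z x a B c : R) :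
  0 <= z <= a^-1 -> - B <= x <= B -> - B <= c <= B ->
  `|z * (x - c)| <= 2 * B / a.
Proof.
move=> zb /andP[x1 x2] /andP[c1 c2]; rewrite mulrC norm_density_mul//.
by rewrite ler_norml; apply/andP; split; lra.
Qed.

(** * Duality for CVaR under a measure of mass 1 *)

Section cvar_duality.
Context d (T : measurableType d) (R : realType) (P : {measure set T -> \bar R}).
Context (X : T -> R) (B a : R) (P1 : P setT = 1%E).
Context (mX : measurable_fun setT X) (XB : forall w, - B <= X w <= B).
Context (a0 : 0 < a).
Implicit Types (zeta : T -> R) (b c : R).

Lemma density_shift_integrable zeta b : - B <= b <= B -> measurable_fun setT zeta ->
  (forall w, 0 <= zeta w <= a^-1) ->
  P.-integrable setT (EFin \o (fun w => zeta w * (X w - b))).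
Proof.
move=> bB mz zb; apply: (bounded_integrable (M := 2 * B / a)) => // [|w].
  by apply: measurable_funM => //; exact: measurable_funB.
exact: norm_density_shift.
Qed.

Lemma density_integrable zeta : measurable_fun setT zeta ->
  (forall w, 0 <= zeta w <= a^-1) -> P.-integrable setT (EFin \o zeta).
Proof.
move=> mz zb; apply: (bounded_integrable (M := a^-1)) => // w.
by have /andP[z0 z1] := zb w; rewrite ger0_norm.
Qed.

Lemma density_shift zeta b : measurable_fun setT zeta ->
  (forall w, 0 <= zeta w <= a^-1) -> \int[P]_w zeta w = 1 ->
  \int[P]_w (X w * zeta w) = b + \int[P]_w (zeta w * (X w - b)).
Proof.
move=> mz zb z1.
have iz := density_integrable mz zb.
have iX : P.-integrable setT (EFin \o (fun w => X w * zeta w)).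
  apply: (bounded_integrable (M := B / a)) => // [|w].
    exact: measurable_funM.
  by apply: norm_density_mul => //; rewrite ler_norml.
have -> : \int[P]_w (zeta w * (X w - b)) =
    \int[P]_w (X w * zeta w - b * zeta w).
  by congr Rintegral; apply/funext => w; rewrite mulrBr mulrC (mulrC b).
have ibz : P.-integrable setT (EFin \o (fun w => b * zeta w)).
  exact: (integrableZl measurableT b iz).
by rewrite RintegralB// RintegralZl// z1 mulr1 addrC subrK.
Qed.

Lemma measurable_excess c : measurable_fun setT (fun w => a^-1 * Num.max (X w - c) 0).
Proof.
apply: measurable_funM => //; apply: measurable_maxr => //.
exact: measurable_funB.
Qed.

Lemma excess_integrable c :
  P.-integrable setT (EFin \o (fun w => a^-1 * Num.max (X w - c) 0)).
Proof.
apply: (bounded_integrable (M := a^-1 * (B + `|c|))) => // [|w].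
  exact: measurable_excess.
have a1 : 0 <= a^-1 by rewrite invr_ge0 ltW.
have /andP[X1 X2] := XB w; have := ler_norm (- c); rewrite normrN => cn.
rewrite normrM (ger0_norm a1) ler_wpM2l// ger0_norm ?le_max ?lexx ?orbT//.
rewrite ge_max; have := normr_ge0 c; move=> ?; apply/andP; split; lra.
Qed.

(** Weak duality, from the pointwise bound [zeta (X - c) <= (X - c)_+ / a] together with
    [density_shift]. *)
Lemma cvar_le c :
  (cvar P a X <= (c + \int[P]_w (a^-1 * Num.max (X w - c) 0))%:E)%E.
Proof.
apply: ge_ereal_sup => _ [zeta [mz zb z1] <-].
have a1 : 0 <= a^-1 by rewrite invr_ge0 ltW.
(* The bounds on [zeta] hold only almost everywhere; clamping to [[0, 1 / a]] makes them hold
   everywhere and changes [zeta] only on a null set. *)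
pose z w := Num.min (Num.max (zeta w) 0) a^-1.
have mz' : measurable_fun setT z.
  by apply: measurable_minr => //; exact: measurable_maxr.
have z'b w : 0 <= z w <= a^-1.
  by rewrite /z le_min le_max lexx orbT a1 ge_min lexx orbT.
have zz' : {ae P, forall w, zeta w = z w}.
  by apply: filterS zb => w /andP[h1 h2]; rewrite /z max_l// min_l.
have -> : (\int[P]_w (X w * zeta w)%:E = (\int[P]_w (X w * z w))%:E)%E.
  rewrite /Rintegral fineK; last first.
    apply: integrable_fin_num => //; apply: (bounded_integrable (M := B / a)) => // [|w].
      exact: measurable_funM.
    by apply: norm_density_mul => //; rewrite ler_norml.
  apply: ae_eq_integral => //.
  - by apply/measurable_EFinP; exact: measurable_funM.
  - by apply/measurable_EFinP; exact: measurable_funM.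
  - by apply: filterS zz' => w -> _.
have z'1 : \int[P]_w z w = 1.
  suff : (\int[P]_w (zeta w)%:E = \int[P]_w (z w)%:E)%E.
    by rewrite z1 /Rintegral => <-.
  apply: ae_eq_integral => //.
  - exact/measurable_EFinP.
  - exact/measurable_EFinP.
  - by apply: filterS zz' => w -> _.
rewrite lee_fin (density_shift c)// lerD2l le_Rintegral//.
- rewrite (_ : _ \o _ = (EFin \o (fun w => z w * (X w - c)))%FUN)//.
  apply: (bounded_integrable (M := a^-1 * (B + `|c|))) => // [|w].
    by apply: measurable_funM => //; exact: measurable_funB.
  rewrite mulrC [leRHS]mulrC norm_density_mul//.
  by rewrite (le_trans (ler_normB _ _))// lerD2r ler_norml.
- exact: excess_integrable.
- move=> w _; have /andP[? ?] := z'b w.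
  apply: (@le_trans _ _ (z w * Num.max (X w - c) 0)).
    by rewrite ler_wpM2l// le_max lexx.
  by rewrite ler_wpM2r// le_max lexx orbT.
Qed.

(* Complementary slackness: [zeta] is [1 / a] above the quantile [c] and [0]
   below it. *)
Lemma cvar_attained : a <= 1 -> exists (c : R) (zeta : T -> R),
  [/\ - B <= c <= B, measurable_fun setT zeta,
      (forall w, 0 <= zeta w <= a^-1) /\ \int[P]_w zeta w = 1,
      forall w, zeta w * (X w - c) = a^-1 * Num.max (X w - c) 0 &
      forall b, cvar P a X = (b + \int[P]_w (zeta w * (X w - b)))%:E].
Proof.
move=> a_le1.
have [c [cB Pgt Pge]] := quantile_exists P1 mX XB a0 a_le1.
have [_ mgt] := measurable_superlevel c mX.
have meq : measurable [set w | X w = c].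
  by have := mX measurableT (measurable_set1 c); rewrite setTI.
have Pfin A : measurable A -> P A \is a fin_num.
  move=> mA; rewrite ge0_fin_numE// (@le_lt_trans _ _ (P setT))// ?P1 ?ltry//.
  by rewrite -P1; apply: le_measure; rewrite ?inE.
pose p := fine (P [set w | c < X w]); pose q := fine (P [set w | X w = c]).
have pE : P [set w | c < X w] = p%:E by rewrite fineK// Pfin.
have qE : P [set w | X w = c] = q%:E by rewrite fineK// Pfin.
have q0 : 0 <= q by rewrite fine_ge0.
have pa : p <= a by move: Pgt; rewrite pE lee_fin.
have apq : a <= p + q.
  rewrite -lee_fin EFinD -pE -qE -measureU//; last first.
    by apply/seteqP; split=> // w [/= + Xc]; rewrite Xc ltxx.
  congr (_ <= P _)%E: Pge; apply/seteqP; split=> w /=.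
    by rewrite le_eqVlt => /predU1P[->|]; [right|left].
  by case=> [/ltW|->].
have a1 : 0 <= a^-1 by rewrite invr_ge0 ltW.
(* The density on the atom [X = c] carries the mass still missing after [1 / a] is placed on
   [X > c]. If [q = 0], then [l = 0] by the convention on division, and [p = a], so no mass is
   missing. *)
pose l := (1 - a^-1 * p) / q.
have ap1 : a^-1 * p <= 1 by rewrite mulrC ler_pdivrMr// mul1r.
have l0 : 0 <= l by rewrite divr_ge0// subr_ge0.
have lq : l * q = 1 - a^-1 * p.
  have [q00|q00] := eqVneq q 0; last by rewrite divfK.
  have -> : p = a by apply/le_anti; rewrite pa; move: apq; rewrite q00 addr0.
  by rewrite q00 mulr0 mulVf ?subrr// gt_eqF.
have la : l <= a^-1.
  have [q00|q00] := eqVneq q 0; first by rewrite /l q00 invr0 mulr0.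
  rewrite ler_pdivrMr ?lt_def ?q00// lerBlDl -mulrDr.
  by rewrite mulrC ler_pdivlMr// mul1r.
pose zeta w := a^-1 * \1_[set w | c < X w] w + l * \1_[set w | X w = c] w.
have zgt w : c < X w -> zeta w = a^-1.
  move=> cX; rewrite /zeta !indicE mem_set// memNset /= ?mulr1 ?mulr0 ?addr0//.
  by move=> Xc; rewrite Xc ltxx in cX.
have zeq w : X w = c -> zeta w = l.
  move=> Xc; rewrite /zeta !indicE memNset ?mem_set//= ?mulr1 ?mulr0 ?add0r//.
  by rewrite Xc ltxx.
have zlt w : X w < c -> zeta w = 0.
  move=> Xc; rewrite /zeta !indicE !memNset ?mulr0 ?addr0//=.
    by move=> H; rewrite H ltxx in Xc.
  by apply/negP; rewrite -leNgt ltW.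
have mz : measurable_fun setT zeta.
  by apply: measurable_funD; apply: measurable_funM => //; exact: measurable_indic.
have zb w : 0 <= zeta w <= a^-1.
  by case: (ltgtP c (X w)) => [/zgt->|/zlt->|/esym/zeq->];
    rewrite ?lexx ?a1 ?l0.
have ind_int A : measurable A -> P.-integrable setT (EFin \o (\1_A : T -> R)).
  move=> mA; apply: (bounded_integrable (M := 1)) => //.
  by move=> w; rewrite ger0_norm indicE ?lern1 ?leq_b1.
have z1 : \int[P]_w zeta w = 1.
  rewrite RintegralD// ?RintegralZl ?Rintegral_indic//; last 4 first.
  - exact: ind_int.
  - exact: ind_int.
  - exact: (integrableZl measurableT (a^-1) (ind_int _ mgt)).
  - exact: (integrableZl measurableT l (ind_int _ meq)).
  by rewrite -/p -/q lq addrC subrK.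
have zX w : zeta w * (X w - c) = a^-1 * Num.max (X w - c) 0.
  case: (ltgtP c (X w)) => cX.
  - by rewrite zgt// max_l// subr_ge0 ltW.
  - by rewrite zlt// mul0r max_r ?mulr0// subr_le0 ltW.
  - by rewrite cX subrr maxxx !mulr0.
exists c, zeta; split=> // b; rewrite -density_shift//.
(* For [<=], weak duality at the quantile, where [zX] identifies the dual objective with the value
   at [zeta]; for [>=], feasibility of [zeta]. *)
apply/le_anti/andP; split.
  rewrite (density_shift c)//; apply: le_trans (cvar_le c) _.
  by under [in X in (_ <= X)%E]eq_Rintegral do rewrite zX.
apply: ereal_sup_ubound; exists zeta.
  split=> //; first exact: aeW.
  by rewrite -[LHS]fineK ?[fine _]z1//; apply: integrable_fin_num => //; exact: density_integrable.
rewrite /Rintegral fineK//; apply: integrable_fin_num => //.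
apply: (bounded_integrable (M := B / a)) => // [|w].
  exact: measurable_funM.
by apply: norm_density_mul => //; rewrite ler_norml.
Qed.

End cvar_duality.

(** * Empirical CVaR as a minimum, and its measurability *)

Lemma Rintegral_empirical d (T : measurableType d) (R : realType) n
    (s : 'I_n.+1 -> T) (f : T -> R) :
  measurable_fun setT f -> (forall x, 0 <= f x) ->
  \int[empirical R s]_w f w = n.+1%:R^-1 * \sum_i f (s i).
Proof.
move=> mf f0; have mEf : measurable_fun setT (EFin \o f) by exact/measurable_EFinP.
(* [msum] is indexed by naturals, hence the detour through [inord], which is the identity on indices
   below [n.+1]. *)
pose m j : {measure set T -> \bar R} := \d_(s (inord j)).
have mE j : (\int[m j]_w (f w)%:E = (f (s (inord j)))%:E)%E.
  by apply: etrans (integral_dirac _ measurableT mEf) _; rewrite diracT mul1e.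
have k0 : 0 <= n.+1%:R^-1 :> R by rewrite invr_ge0.
rewrite /Rintegral
  (eq_measure_integral (mscale (NngNum k0) (msum m n.+1)))/=; last first.
  move=> A mA _; rewrite /mscale/= /msum /empirical; congr (_ * _)%E.
  by apply: eq_bigr => i _; rewrite /m inord_val.
rewrite (ge0_integral_mscale (msum m n.+1))//; last by move=> x _; rewrite lee_fin.
rewrite ge0_integral_measure_sum//; last by move=> x _; rewrite lee_fin.
rewrite (eq_bigr (fun i => (f (s i))%:E)) ?sumEFin// => i _.
by rewrite mE inord_val.
Qed.

Section empirical_cvar.
Context d (T : measurableType d) (R : realType) (X : T -> R) (B a : R).
Context (mX : measurable_fun setT X) (XB : forall w, - B <= X w <= B).
Context (a0 : 0 < a).

(** The Rockafellar-Uryasev dual objective of the empirical measure. Sample size [n.+1] guarantees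
    total mass 1. *)
Definition empirical_objective n (s : 'I_n.+1 -> T) (c : R) : R :=
  c + n.+1%:R^-1 * \sum_i (a^-1 * Num.max (X (s i) - c) 0).

Lemma Rintegral_empirical_excess n (s : 'I_n.+1 -> T) c :
  \int[empirical R s]_w (a^-1 * Num.max (X w - c) 0) =
  n.+1%:R^-1 * \sum_i (a^-1 * Num.max (X (s i) - c) 0).
Proof.
rewrite Rintegral_empirical//; first exact: measurable_excess.
by move=> w; rewrite mulr_ge0 ?invr_ge0 ?(ltW a0)// le_max lexx orbT.
Qed.

Lemma cvar_empirical_le n (s : 'I_n.+1 -> T) c :
  (cvar (empirical R s) a X <= (empirical_objective s c)%:E)%E.
Proof.
rewrite /empirical_objective -Rintegral_empirical_excess.
have E1 : empirical R s setT = 1%E by rewrite empirical_setT.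
exact: cvar_le E1 mX XB a0 c.
Qed.

Lemma cvar_empirical_attained n (s : 'I_n.+1 -> T) : a <= 1 ->
  exists c, - B <= c <= B /\
    (cvar (empirical R s) a X = (empirical_objective s c)%:E)%E.
Proof.
move=> a1; have E1 : empirical R s setT = 1%E by rewrite empirical_setT.
have [c [zeta [cB _ _ zX cvarE]]] := cvar_attained E1 mX XB a0 a1.
exists c; split=> //; rewrite (cvarE c) /empirical_objective.
by rewrite -Rintegral_empirical_excess; under eq_Rintegral do rewrite zX.
Qed.

(** Raising [c] can only shrink the excess, so the linear term alone bounds the growth. This lets a
    real minimiser be replaced by a nearby larger rational. *)
Lemma empirical_objective_ler n (s : 'I_n.+1 -> T) b c : b <= c ->
  empirical_objective s c <= empirical_objective s b + (c - b).
Proof.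
move=> bc; rewrite /empirical_objective addrAC subrKC lerD2l.
rewrite ler_wpM2l ?invr_ge0// ler_sum// => i _.
rewrite ler_wpM2l ?invr_ge0 ?(ltW a0)// ge_max !le_max lexx orbT andbT.
by rewrite lerD2l lerN2 bc.
Qed.

Lemma measurable_empirical_objective d' (T' : measurableType d') n
    (S : 'I_n.+1 -> T' -> T) c : (forall i, measurable_fun setT (S i)) ->
  measurable_fun setT (fun w => empirical_objective (S^~ w) c).
Proof.
move=> mS; apply: measurable_funD => //; apply: measurable_funM => //.
apply: measurable_sum => i.
exact: (measurableT_comp (measurable_excess a mX c) (mS i)).
Qed.

(** The empirical CVaR is the minimum of the objective over [c], so it is below [y] exactly when the
    objective is below [y] at some rational; this turns the sublevel set into a countable union. *)
Lemma measurable_cvar_empirical d' (T' : measurableType d') n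
    (S : 'I_n.+1 -> T' -> T) : (forall i, measurable_fun setT (S i)) -> a <= 1 ->
  measurable_fun setT (fun w => cvar (empirical R (S^~ w)) a X).
Proof.
move=> mS a1; apply: (measurability _ (ErealGenInftyO.measurableE R)).
move=> _ [_ [y ->] <-]; rewrite setTI.
have -> : (fun w => cvar (empirical R (S^~ w)) a X) @^-1` `]-oo, y%:E[ =
    \bigcup_(q : rat) ~` [set w | y <= empirical_objective (S^~ w) (ratr q)].
  apply/seteqP; split=> w /=.
    rewrite in_itv/=; have [c [_ ->]] := cvar_empirical_attained (S^~ w) a1.
    rewrite lte_fin => cy.
    (* The slack [y - objective(c)] bounds how far to the right of [c] the rational may lie. *)
    have /rat_in_itvoo[q] : c < c + (y - empirical_objective (S^~ w) c).
      by rewrite ltrDl subr_gt0.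
    rewrite in_itv/= => /andP[cq qy]; exists q => //=.
    apply/negP; rewrite -ltNge.
    by have := empirical_objective_ler (S^~ w) (ltW cq); lra.
  move=> [q _ /=] /negP; rewrite -ltNge in_itv/= => qy.
  by apply: le_lt_trans (cvar_empirical_le _ (ratr q)) _; rewrite lte_fin.
apply: bigcupT_measurable_rat => q; apply: measurableC.
by apply: (measurable_superlevel _ _).1; exact: measurable_empirical_objective.
Qed.

End empirical_cvar.

(** * Exponential moments of i.i.d. sums *)

(** Independence is given for events only. With finitely many values the product expands over all
    value patterns [phi], each pattern event has product probability, and the sum over patterns
    factors back into a power. *)
Lemma iid_integral_prod_finite d d' (T : measurableType d)
    (T' : measurableType d') (R : realType) (Q : probability T R)
    (P : probability T' R) n (S : 'I_n -> T -> T') K (h : T' -> 'I_K)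
    (g : 'I_K -> R) :
  iid_samples Q P S -> (forall v, measurable (h @^-1` [set v])) ->
  (forall v, 0 <= g v) ->
  \int[Q]_w (\prod_i g (h (S i w))) = (\int[P]_x g (h x)) ^+ n.
Proof.
move=> [mS PS indep] mh g0.
have gE v : g v = \sum_u g u * (v == u)%:R.
  rewrite (bigD1 v)//= eqxx mulr1 big1 ?addr0// => u /negPf.
  by rewrite eq_sym => ->; rewrite mulr0.
have hE u x : \1_(h @^-1` [set u]) x = (h x == u)%:R :> R.
  rewrite indicE; have [hx|/eqP hx] := eqVneq (h x) u; first by rewrite mem_set.
  by rewrite memNset.
pose p v := fine (P (h @^-1` [set v])).
have PE v : P (h @^-1` [set v]) = (p v)%:E.
  by rewrite fineK// fin_num_measure.
have -> : \int[P]_x g (h x) = \sum_u g u * p u.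
  rewrite /Rintegral.
  under eq_integral do rewrite gE -sumEFin.
  rewrite ge0_integral_sum//; last 2 first.
  - move=> u; apply/measurable_EFinP; apply: measurable_funM => //.
    rewrite (_ : (fun x => _) = \1_(h @^-1` [set u])); first exact: measurable_indic.
    by apply/funext => x; rewrite hE.
  - by move=> u x _; rewrite lee_fin mulr_ge0.
  rewrite (eq_bigr (fun u => (g u * p u)%:E)) ?sumEFin// => u _.
  under eq_integral do rewrite EFinM.
  rewrite (_ : (fun x => _) = (fun x => ((g u)%:E * (\1_(h @^-1` [set u]) x)%:E)%E)).
    rewrite ge0_integralZl//; last 2 first.
    - by apply/measurable_EFinP; exact: measurable_indic.
    - by rewrite lee_fin.
    by rewrite integral_indic// setIT EFinM -PE.
  by apply/funext => x; rewrite hE.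
(* The event that sample [i] takes the value [phi i] for every [i]. *)
pose E (phi : {ffun 'I_n -> 'I_K}) :=
  \bigcap_(i in [set` [set: 'I_n]%SET]) (S i @^-1` (h @^-1` [set phi i])).
have mE phi : measurable (E phi).
  apply: fin_bigcap_measurable => // i _.
  by rewrite -[X in measurable X]setTI; exact: mS.
have QE phi : Q (E phi) = (\prod_i p (phi i))%:E.
  rewrite indep//; rewrite (eq_bigr (fun i => (p (phi i))%:E)); last first.
    by move=> i _; rewrite PS// PE.
  by rewrite prodEFin; congr (_%:E); apply: eq_bigl => i; rewrite inE.
have prodE w : \prod_i g (h (S i w)) =
    \sum_(phi : {ffun 'I_n -> 'I_K}) (\prod_i g (phi i)) * \1_(E phi) w.
  under eq_bigr do rewrite gE.
  rewrite bigA_distr_bigA; apply: eq_bigr => phi _; rewrite big_split/=.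
  congr (_ * _); rewrite indicE.
  have [Ew|nEw] := boolP (w \in E phi).
    rewrite big1// => i _; move: Ew; rewrite inE => /(_ i); rewrite /= inE.
    by move=> -> //; rewrite eqxx.
  apply/eqP/prodf_eq0; apply: contrapT => H.
  move/negP: nEw; apply; rewrite inE => i _ /=; apply: contrapT => hi.
  by apply: H; exists i => //; move/eqP/negPf: hi => ->.
rewrite /Rintegral.
under eq_integral do rewrite prodE -sumEFin.
rewrite ge0_integral_sum//; last 2 first.
- move=> phi; apply/measurable_EFinP; apply: measurable_funM.
    exact: measurable_cst.
  by apply: measurable_indic; exact: mE.
- by move=> phi w _; rewrite lee_fin mulr_ge0// prodr_ge0.
rewrite (eq_bigr (fun phi : {ffun 'I_n -> 'I_K} =>
  (\prod_i (g (phi i) * p (phi i)))%:E)).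
  rewrite sumEFin /= -(bigA_distr_bigA (fun _ u => g u * p u)).
  by rewrite prodr_const card_ord.
move=> phi _; under eq_integral do rewrite EFinM.
rewrite ge0_integralZl//; last 2 first.
- by apply/measurable_EFinP; exact: measurable_indic.
- by rewrite lee_fin prodr_ge0.
by rewrite integral_indic// setIT big_split/= EFinM -QE.
Qed.

Lemma prob_Rintegral_cst d (T : measurableType d) (R : realType)
    (P : probability T R) (c : R) : \int[P]_w c = c.
Proof.
rewrite Rintegral_cst// -[RHS]mulr1; congr (_ * _).
exact: (congr1 fine (probability_setT P)).
Qed.

Lemma prob_bounded_integrable d (T : measurableType d) (R : realType)
    (P : probability T R) (f : T -> R) (M : R) :
  measurable_fun setT f -> (forall w, `|f w| <= M) ->
  P.-integrable setT (EFin \o f).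
Proof. by move=> mf fM; apply: (bounded_integrable (M := M)) => //; exact: probability_setT. Qed.

Lemma measurable_expR_comp d (T : measurableType d) (R : realType)
    (f : T -> R) :
  measurable_fun setT f -> measurable_fun setT (fun w => expR (f w)).
Proof. move=> mf; by apply: measurableT_comp => //; exact: measurable_expR. Qed.

Lemma prob_expR_integrable d (T : measurableType d) (R : realType)
    (P : probability T R) (f : T -> R) (M : R) :
  measurable_fun setT f -> (forall w, `|f w| <= M) ->
  P.-integrable setT (EFin \o (fun w => expR (f w))).
Proof.
move=> mf fM; apply: (prob_bounded_integrable _ (M := expR M)).
  exact: measurable_expR_comp.
move=> w; rewrite ger0_norm ?expR_ge0// ler_expR.
exact: le_trans (ler_norm _) (fM w).
Qed.

Lemma iid_sum_measurable d d' (T : measurableType d) (T' : measurableType d')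
    (R : realType) n (S : 'I_n -> T -> T') (F : T' -> R) :
  (forall i, measurable_fun setT (S i)) -> measurable_fun setT F ->
  measurable_fun setT (fun w => \sum_i F (S i w)).
Proof.
by move=> mS mF; apply: measurable_sum => i; exact: (measurableT_comp mF (mS i)).
Qed.

Lemma ler_norm_sum_const (R : realType) n (f : 'I_n -> R) (M : R) :
  (forall i, `|f i| <= M) -> `|\sum_i f i| <= n%:R * M.
Proof.
move=> fM; apply: le_trans (ler_norm_sum _ _ _) _.
apply: le_trans (ler_sum _ (fun i _ => fM i)) _.
by rewrite sumr_const card_ord mulr_natl.
Qed.

(* [F] is rounded up to a multiple of [eta], to which the finite-valued case
   applies; then [eta] tends to [0]. *)
Lemma iid_exp_sum_le d d' (T : measurableType d)
    (T' : measurableType d') (R : realType) (Q : probability T R)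
    (P : probability T' R) n (S : 'I_n -> T -> T') (F : T' -> R) (M : R) :
  iid_samples Q P S -> measurable_fun setT F -> (forall x, `|F x| <= M) ->
  \int[Q]_w expR (\sum_i F (S i w)) <= (\int[P]_x expR (F x)) ^+ n.
Proof.
move=> iid mF FM; have mS : forall i, measurable_fun setT (S i) by case: iid.
set b := \int[P]_x expR (F x); set a := \int[Q]_w _.
have FMb x : - M <= F x <= M by rewrite -ler_norml.
have intF := prob_expR_integrable P mF FM.
have step eta : 0 < eta -> a <= expR (n%:R * eta) * b ^+ n.
  move=> eta0.
  (* [h x] is the index of the cell of width [eta], counted from [- M], that contains [F x]; [K]
     cells cover [[- M, M]], so [inord] never falls back to its default. [g] evaluates the
     exponential at the upper end of the cell, whence [exp F <= g h <= exp eta * exp F]. *)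
  pose K := (Num.truncn (2 * M / eta)).+1.
  pose h x : 'I_K := inord (Num.truncn ((F x + M) / eta)).
  pose g (v : 'I_K) := expR (v.+1%:R * eta - M).
  have FM0 x : 0 <= (F x + M) / eta.
    by have /andP[? _] := FMb x; rewrite divr_ge0 ?(ltW eta0)//; lra.
  have hE x : h x = Num.truncn ((F x + M) / eta) :> nat.
    rewrite inordK// ltnS le_truncn// ler_pM2r ?invr_gt0//.
    by have /andP[_ ?] := FMb x; lra.
  have hb x : (h x)%:R * eta - M <= F x < (h x).+1%:R * eta - M.
    have /andP[h1 h2] := truncn_itv (FM0 x).
    by move: h1 h2; rewrite -hE ler_pdivlMr// ltr_pdivrMr// => h1 h2; lra.
  have mh v : measurable (h @^-1` [set v]).
    have -> : h @^-1` [set v] = [set x | (v%:R * eta - M) <= F x] `&`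
        ~` [set x | (v.+1%:R * eta - M) <= F x].
      apply/seteqP; split=> x /=.
        move=> <-; have /andP[h1 h2] := hb x; split=> //.
        by apply/negP; rewrite -ltNge.
      move=> [h1 /negP]; rewrite -ltNge => h2; apply/val_inj => /=.
      rewrite hE; apply/eqP; rewrite truncn_eq//.
      by rewrite ler_pdivlMr// ltr_pdivrMr//; apply/andP; split; lra.
    by apply: measurableI; [|apply: measurableC];
      apply: (measurable_superlevel _ mF).1.
  have g0 v : 0 <= g v by exact: expR_ge0.
  have gle x : g (h x) <= expR eta * expR (F x).
    rewrite -expRD ler_expR; have /andP[h1 _] := hb x.
    by rewrite -natr1 mulrDl mul1r; lra.
  have leg x : expR (F x) <= g (h x).
    by rewrite ler_expR; have /andP[_ /ltW] := hb x.
  have mg : measurable_fun setT (fun x => g (h x)).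
    rewrite (_ : (fun x => _) = fun x => \sum_v g v * \1_(h @^-1` [set v]) x).
      apply: measurable_sum => v; apply: measurable_funM.
        exact: measurable_cst.
      by apply: measurable_indic; exact: mh.
    apply/funext => x; rewrite (bigD1 (h x))//= indicE mem_set// mulr1.
    rewrite big1 ?addr0// => v /eqP vh; rewrite indicE memNset ?mulr0//=.
    by move=> hv; exact: vh.
  have intg : P.-integrable setT (EFin \o (fun x => g (h x))).
    apply: (prob_bounded_integrable _ (M := expR eta * expR M)) => // x.
    rewrite ger0_norm//; apply: le_trans (gle x) _.
    by rewrite ler_wpM2l ?expR_ge0// ler_expR; have /andP[] := FMb x.
  apply: (@le_trans _ _ (\int[Q]_w \prod_i g (h (S i w)))).
    apply: le_Rintegral => //.
    - apply: (prob_expR_integrable _ (M := n%:R * M)).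
        exact: iid_sum_measurable.
      by move=> w; exact: ler_norm_sum_const.
    - apply: (prob_bounded_integrable _ (M := (expR eta * expR M) ^+ n)).
        apply: measurable_prod => i _.
        exact: (measurableT_comp mg (mS i)).
      move=> w; rewrite normr_prod -[n in _ ^+ n]card_ord -prodr_const.
      apply: ler_prod => i _; rewrite normr_ge0/= ger0_norm//.
      apply: le_trans (gle _) _.
      by rewrite ler_wpM2l ?expR_ge0// ler_expR; have /andP[] := FMb (S i w).
    - move=> w _; rewrite expR_sum; apply: ler_prod => i _.
      by rewrite expR_ge0 leg.
  rewrite (iid_integral_prod_finite iid mh g0).
  have -> : expR (n%:R * eta) * b ^+ n = (expR eta * b) ^+ n.
    by rewrite exprMn -expRM_natl mulr_natl.
  apply: lerXn2r; rewrite ?nnegrE.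
  - by apply: Rintegral_ge0.
  - by rewrite mulr_ge0 ?expR_ge0//; apply: Rintegral_ge0 => x _; exact: expR_ge0.
  - rewrite /b -RintegralZl//; apply: le_Rintegral => //.
    exact: (integrableZl measurableT _ intF).
have b0 : 0 < b ^+ n.
  rewrite exprn_gt0//; apply: (@lt_le_trans _ _ (expR (- M))); first exact: expR_gt0.
  have -> : expR (- M) = \int[P]_x expR (- M).
    by rewrite prob_Rintegral_cst.
  apply: le_Rintegral => //.
    by apply: (prob_expR_integrable _ (M := `|M|)) => // w; rewrite normrN.
  by move=> x _; rewrite ler_expR; have /andP[] := FMb x.
rewrite leNgt; apply/negP => ba.
have a0 := lt_trans b0 ba.
have lnba : ln (b ^+ n) < ln a by rewrite ltr_ln.
(* If the bound failed, this [eta] would satisfy [n eta < ln a - ln (b ^+ n)], contradicting [step].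
   Dividing by [n.+1] makes this strict and covers [n = 0]. *)
pose eta := (ln a - ln (b ^+ n)) / n.+1%:R.
have eta0 : 0 < eta by rewrite divr_gt0// subr_gt0.
have := step _ eta0; rewrite -ler_ln ?posrE ?mulr_gt0 ?expR_gt0//.
rewrite lnM ?posrE ?expR_gt0// expRK.
have : n%:R * eta = ln a - ln (b ^+ n) - eta.
  by rewrite /eta -[X in _ = X - _](divfK (x := n.+1%:R)) ?pnatr_eq0// -natr1; ring.
lra.
Qed.

(** * A Bernstein-type upper tail bound *)

(** Squaring [1 - x / 2 <= exp (- x / 2)] gives [exp x <= (1 - x / 2)^-2]. The quadratic dominates
    this because [1 - 3 x + x^2 >= 0] for [x <= 1 / 4]. *)
Lemma expR_le_quadratic (R : realType) (x : R) :
  x <= 4^-1 -> expR x <= 1 + x + x ^+ 2.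
Proof.
move=> x4; have h := expR_ge1Dx (- (x / 2)).
have h2 : (1 - x / 2) ^+ 2 <= (expR x)^-1.
  rewrite -expRN (_ : - x = - (x / 2) + - (x / 2)); last by field.
  by rewrite expRD expr2 ler_pM//; lra.
have y0 : 0 < (1 - x / 2) ^+ 2 by rewrite exprn_gt0//; lra.
have q0 : 0 <= 1 + x + x ^+ 2 by nra.
have : expR x <= ((1 - x / 2) ^+ 2)^-1.
  by rewrite -[leLHS]invrK lef_pV2// posrE invr_gt0 expR_gt0.
move/le_trans; apply; rewrite -[leLHS]mul1r ler_pdivrMr//.
have -> : (1 + x + x ^+ 2) * (1 - x / 2) ^+ 2 =
  1 + (x / 2) ^+ 2 * (1 - 3 * x + x ^+ 2) by field.
by rewrite lerDl mulr_ge0 ?sqr_ge0//; have := sqr_ge0 x; lra.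
Qed.

(** Chernoff's method with a free parameter [l]: the quadratic bound on [exp] controls the moment
    generating function by the uncentred second moment. *)
Lemma iid_upper_tail d d' (T : measurableType d)
    (T' : measurableType d') (R : realType) (Q : probability T R)
    (P : probability T' R) n (S : 'I_n -> T -> T') (Y : T' -> R)
    (M V l e : R) :
  iid_samples Q P S -> measurable_fun setT Y -> (forall x, `|Y x| <= M) ->
  \int[P]_x (Y x ^+ 2) <= V -> 0 < l -> l * M <= 4^-1 ->
  (Q [set w | (n%:R * (\int[P]_x Y x + e) <= \sum_i Y (S i w))%R] <=
   (expR (n%:R * (l ^+ 2 * V - l * e)))%:E)%E.
Proof.
move=> iid mY YM YV l0 lM; have mS : forall i, measurable_fun setT (S i) by case: iid.
set m := \int[P]_x Y x; set t := n%:R * (m + e).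
pose F x := l * Y x.
have mF : measurable_fun setT F by exact: measurable_funM.
have FM x : `|F x| <= l * M by rewrite normrM (gtr0_norm l0) ler_pM2l.
have mA : measurable [set w | t <= \sum_i Y (S i w)].
  by apply: (measurable_superlevel _ _).1; exact: iid_sum_measurable.
set A := [set w | _] in mA *.
have iY := prob_bounded_integrable P mY YM.
have iY2 : P.-integrable setT (EFin \o (fun x => Y x ^+ 2)).
  apply: (prob_bounded_integrable _ (M := M ^+ 2)); first exact: measurable_funX.
  by move=> x; rewrite normrX lerXn2r ?nnegrE//; exact: le_trans (normr_ge0 _) (YM x).
have i1 : P.-integrable setT (EFin \o (fun x => 1 : R)).
  by apply: (prob_bounded_integrable _ (M := 1)) => // x; rewrite normr1.
have ilY : P.-integrable setT (EFin \o (fun x => l * Y x)).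
  exact: (integrableZl measurableT l iY).
have il2Y2 : P.-integrable setT (EFin \o (fun x => l ^+ 2 * Y x ^+ 2)).
  exact: (integrableZl measurableT (l ^+ 2) iY2).
have i1lY : P.-integrable setT (EFin \o (fun x => 1 + l * Y x)).
  exact: (integrableD measurableT i1 ilY).
have mgf : \int[P]_x expR (F x) <= expR (l * m + l ^+ 2 * V).
  apply: (@le_trans _ _ (\int[P]_x (1 + l * Y x + l ^+ 2 * Y x ^+ 2))).
    apply: le_Rintegral => //.
    - exact: prob_expR_integrable FM.
    - exact: (integrableD measurableT i1lY il2Y2).
    - move=> x _; rewrite -exprMn; apply: expR_le_quadratic.
      by apply: le_trans lM; exact: le_trans (ler_norm _) (FM x).
  rewrite !RintegralD// !RintegralZl// prob_Rintegral_cst -/m -addrA.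
  apply: le_trans (expR_ge1Dx _); rewrite !lerD2l ler_wpM2l//.
  exact: sqr_ge0.
(* Markov's inequality in the form [1_A exp (l t) <= exp (\sum_i F (S i w))]. *)
have markov : fine (Q A) * expR (l * t) <= \int[Q]_w expR (\sum_i F (S i w)).
  rewrite -Rintegral_indic// mulrC -RintegralZl//; last first.
    by apply: (prob_bounded_integrable _ (M := 1)) => // w;
      rewrite ger0_norm indicE ?lern1 ?leq_b1.
  apply: le_Rintegral => //.
  - apply: (prob_bounded_integrable _ (M := expR (l * t))).
      by apply: measurable_funM; [exact: measurable_cst|exact: measurable_indic].
    move=> w; rewrite normrM ger0_norm ?expR_ge0// ler_piMr ?expR_ge0//.
    by rewrite ger0_norm indicE ?lern1 ?leq_b1.
  - apply: (prob_expR_integrable _ (M := n%:R * (l * M))).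
      exact: iid_sum_measurable.
    by move=> w; exact: ler_norm_sum_const.
  - move=> w _; rewrite indicE; have [wA|wA] := boolP (w \in A); last first.
      by rewrite mulr0 expR_ge0.
    rewrite mulr1 ler_expR -mulr_sumr ler_pM2l//.
    by rewrite inE in wA.
have QA : Q A \is a fin_num by exact: fin_num_measure.
rewrite -(fineK QA) lee_fin.
rewrite -(ler_pM2r (expR_gt0 (l * t))) -expRD.
apply: le_trans markov _; apply: le_trans (iid_exp_sum_le iid mF FM) _.
apply: (@le_trans _ _ (expR (l * m + l ^+ 2 * V) ^+ n)).
  by rewrite lerXn2r ?nnegrE ?expR_ge0//; apply: Rintegral_ge0 => x _; exact: expR_ge0.
rewrite -expRM_natl ler_expR -mulr_natl le_eqVlt; apply/orP; left; apply/eqP.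
by rewrite /t; ring.
Qed.

(** * Concentration of the empirical CVaR *)

(** Pointwise [zeta^2 <= zeta / a] and [(X - b)^2 <= 4 B^2]; the remaining factor [zeta] integrates
    to 1. This yields [1 / a] where the sup bound alone would give [1 / a^2]. *)
Lemma density_sq_integral_le d (T : measurableType d) (R : realType)
    (P : probability T R) (X zeta : T -> R) (B a b : R) :
  measurable_fun setT X -> (forall w, - B <= X w <= B) -> 0 < a ->
  measurable_fun setT zeta -> (forall w, 0 <= zeta w <= a^-1) ->
  \int[P]_w zeta w = 1 -> - B <= b <= B ->
  \int[P]_w ((zeta w * (X w - b)) ^+ 2) <= 4 * B ^+ 2 / a.
Proof.
move=> mX XB a0 mz zb z1 bB; have P1 := probability_setT P.
have iz := density_integrable P1 mz zb.
have -> : 4 * B ^+ 2 / a = \int[P]_w (4 * B ^+ 2 / a * zeta w).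
  by rewrite RintegralZl// z1 mulr1.
apply: le_Rintegral => //.
- apply: (prob_bounded_integrable _ (M := (2 * B / a) ^+ 2)).
    apply: measurable_funX; apply: measurable_funM => //.
    exact: measurable_funB.
  move=> w; rewrite normrX lerXn2r ?nnegrE//; last exact: norm_density_shift.
  exact: le_trans (normr_ge0 _) (norm_density_shift (zb w) (XB w) bB).
- exact: (integrableZl measurableT _ iz).
- move=> w _; have /andP[z0 za] := zb w.
  have -> : 4 * B ^+ 2 / a * zeta w = zeta w * (a^-1 * (2 * B) ^+ 2).
    by rewrite exprMn; ring.
  rewrite exprMn expr2 -mulrA ler_wpM2l// ler_pM ?sqr_ge0//.
  rewrite -[leLHS]real_normK ?num_real// lerXn2r ?nnegrE//.
    by have /andP[? ?] := bB; lra.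
  by rewrite ler_norml; have /andP[? ?] := bB; have /andP[? ?] := XB w;
    apply/andP; split; lra.
Qed.

(* [\sum_i zeta (s i) * (X (s i) - c')] minorises the excess and is affine in
   [c'], so controlling it at [c' = - B] and [c' = B] is enough. *)
Lemma empirical_objective_close (R : realType) d (T : measurableType d)
    (X zeta : T -> R) (B a r c e : R) n (s : 'I_n.+1 -> T) :
  0 < a -> 0 < B -> (forall w, 0 <= zeta w <= a^-1) ->
  (forall w, zeta w * (X w - c) = a^-1 * Num.max (X w - c) 0) ->
  \sum_i (zeta (s i) * (X (s i) - c)) <= n.+1%:R * (r - c + e) ->
  n.+1%:R * (r - (- B) - e) <= \sum_i (zeta (s i) * (X (s i) - (- B))) ->
  n.+1%:R * (r - B - e) <= \sum_i (zeta (s i) * (X (s i) - B)) ->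
  empirical_objective X a s c <= r + e /\
  forall c', - B <= c' <= B -> r - e <= empirical_objective X a s c'.
Proof.
move=> a0 B0 zb zX up loN lo; have N0 : 0 < n.+1%:R :> R by rewrite ltr0n.
split=> [|c' /andP[c1 c2]]; rewrite /empirical_objective.
  rewrite -lerBrDl mulrC ler_pdivrMr//; under eq_bigr do rewrite -zX.
  by apply: le_trans up _; rewrite mulrC ler_wpM2r ?(ltW N0)//; lra.
rewrite -lerBlDl mulrC ler_pdivlMr//.
apply: (@le_trans _ _ (\sum_i (zeta (s i) * (X (s i) - c')))); last first.
  apply: ler_sum => i _; have /andP[z0 za] := zb (s i).
  apply: (@le_trans _ _ (zeta (s i) * Num.max (X (s i) - c') 0)).
    by rewrite ler_wpM2l// le_max lexx.
  by rewrite ler_wpM2r// le_max lexx orbT.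
have sumE b : \sum_i (zeta (s i) * (X (s i) - b)) =
    \sum_i (zeta (s i) * X (s i)) - b * \sum_i zeta (s i).
  rewrite mulr_sumr -sumrB; apply: eq_bigr => i _; ring.
move: loN lo; rewrite !sumE.
set D := \sum_i _ * _; set A := \sum_i zeta _ => loN lo.
(* [c'] is the convex combination of [- B] and [B] with weights [(B - c') / (2 B)] and
   [(B + c') / (2 B)]; [h1 + h2] is [2 B] times the goal. *)
have h1 : 0 <= (B - c') * (D - (- B) * A - n.+1%:R * (r - (- B) - e)).
  by rewrite mulr_ge0// subr_ge0.
have h2 : 0 <= (B + c') * (D - B * A - n.+1%:R * (r - B - e)).
  by rewrite mulr_ge0 ?subr_ge0//; lra.
rewrite -subr_ge0 -(pmulr_rge0 _ (_ : 0 < 2 * B)) ?mulr_gt0//.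
have := addr_ge0 h1 h2; congr (_ <= _); ring.
Qed.

(** The factor 3 is a union bound over three tail events: one upper tail at the quantile [c], and
    lower tails at [- B] and [B]. *)
Lemma iid_cvar_close d (T : measurableType d) (R : realType)
    (P : probability T R) (X : T -> R) (B a e : R) :
  measurable_fun setT X -> (forall w, - B <= X w <= B) -> 0 < B ->
  0 < a -> a <= 1 -> 0 < e <= B ->
  forall n d' (T' : measurableType d') (Q : probability T' R)
    (S : 'I_n.+1 -> T' -> T),
  iid_samples Q P S ->
  let E := [set w | (`|cvar P a X - cvar (empirical R (S^~ w)) a X|
                     <= e%:E)%E] in
  measurable E /\
  ((1 - 3 * expR (- (n.+1%:R * (a * e ^+ 2 / (16 * B ^+ 2)))))%:E <= Q E)%E.
Proof.
move=> mX XB B0 a0 a1 /andP[e0 eB] n d' T' Q S iid E.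
have mS : forall i, measurable_fun setT (S i) by case: iid.
have P1 := probability_setT P.
have [c [zeta [cB mz [zb z1] zX cvarE]]] := cvar_attained P1 mX XB a0 a1.
(* [r] is the CVaR itself, and the mean of [zeta (X - b)] is [r - b] for every [b]. *)
pose r := \int[P]_w (zeta w * (X w - 0)).
have cvarr : cvar P a X = r%:E by rewrite (cvarE 0) add0r.
have intE b : \int[P]_w (zeta w * (X w - b)) = r - b.
  have : (b + \int[P]_w (zeta w * (X w - b)))%:E = r%:E by rewrite -cvarE.
  by case=> <-; rewrite addrC addKr.
have mE : measurable E.
  rewrite -[E]setTI; apply: emeasurable_fun_infty_c => //.
  apply: measurableT_comp => //; apply: emeasurable_funB => //.
  exact: measurable_cvar_empirical.
split=> //.
pose t := expR (- (n.+1%:R * (a * e ^+ 2 / (16 * B ^+ 2)))).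
(* The sign [k] is 1 for upper and -1 for lower deviations, so that one tail bound serves both. *)
pose Y (k : R) b x := k * (zeta x * (X x - b)).
have mY k b : measurable_fun setT (Y k b).
  apply: measurable_funM => //; apply: measurable_funM => //.
  exact: measurable_funB.
pose A k b := [set w | n.+1%:R * (k * (r - b) + e) <= \sum_i Y k b (S i w)].
have mA k b : measurable (A k b).
  by apply: (measurable_superlevel _ _).1; exact: iid_sum_measurable.
have tail k b : `|k| = 1 -> - B <= b <= B -> (Q (A k b) <= t%:E)%E.
  (* With [V = 4 B^2 / a], this is the minimiser [e / (2 V)] of [l^2 V - l e], with value
     [- a e^2 / (16 B^2)]. The constraint [l M <= 1 / 4] becomes [e <= B]. *)
  move=> k1 bB; pose l := a * e / (8 * B ^+ 2).
  have BB0 : 0 < B ^+ 2 by rewrite exprn_gt0.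
  have l0 : 0 < l by rewrite divr_gt0 ?mulr_gt0.
  have YM x : `|Y k b x| <= 2 * B / a.
    by rewrite normrM k1 mul1r; exact: norm_density_shift.
  have YV : \int[P]_x (Y k b x ^+ 2) <= 4 * B ^+ 2 / a.
    have k2 : k ^+ 2 = 1 by rewrite -real_normK ?num_real// k1 expr1n.
    under eq_Rintegral do rewrite exprMn k2 mul1r.
    exact: density_sq_integral_le.
  have lM : l * (2 * B / a) <= 4^-1.
    have -> : l * (2 * B / a) = (e / B) / 4 by rewrite /l; field; rewrite !gt_eqF.
    by rewrite ler_piMl ?invr_ge0// ler_pdivrMr// mul1r.
  have := iid_upper_tail e iid (mY k b) YM YV l0 lM.
  rewrite RintegralZl//; last exact: density_shift_integrable P1 mX XB _ _ bB mz zb.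
  rewrite intE => /le_trans; apply; rewrite lee_fin ler_expR.
  rewrite -[leRHS]mulrN ler_wpM2l// le_eqVlt; apply/orP; left; apply/eqP.
  by rewrite /l; field; rewrite !gt_eqF.
have sub : ~` E `<=` A 1 c `|` A (-1) (- B) `|` A (-1) B.
  have notA k b w : ~ A k b w ->
      k * \sum_i (zeta (S i w) * (X (S i w) - b)) < n.+1%:R * (k * (r - b) + e).
    by move=> /negP; rewrite -ltNge -mulr_sumr.
  rewrite -[X in _ `<=` X]setCK; apply: subsetC; rewrite !setCU.
  move=> w [[n1 n2] n3]; move: (notA _ _ _ n1) (notA _ _ _ n2) (notA _ _ _ n3).
  rewrite !mul1r !mulN1r => up loN lo.
  have [] := @empirical_objective_close _ _ _ X zeta B a r c e n (S^~ w) a0 B0 zb zX.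
  - exact: ltW.
  - by rewrite -lerN2; apply: le_trans (ltW loN) _; lra.
  - by rewrite -lerN2; apply: le_trans (ltW lo) _; lra.
  move=> upE loE; have [c' [cB' Ec']] := cvar_empirical_attained mX XB a0 (S^~ w) a1.
  have := cvar_empirical_le mX XB a0 (S^~ w) c.
  rewrite /E /= cvarr Ec' lee_fin => Ele.
  rewrite -EFinB abse_EFin lee_fin ler_norml; have := loE _ cB'.
  by move=> ?; apply/andP; split; lra.
have QC : (Q (~` E) <= (3 * t)%:E)%E.
  apply: (@le_trans _ _ (Q (A 1 c `|` A (-1) (- B) `|` A (-1) B))).
    apply: le_measure; rewrite ?inE//; first exact: measurableC.
    by do 2 apply: measurableU => //.
  have -> : (3 * t)%:E = (t%:E + t%:E + t%:E)%E by rewrite -!EFinD; congr EFin; ring.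
  apply: le_trans (measureU2 _ _ _) _ => //; first exact: measurableU.
  apply: leeD; last by apply: tail; rewrite ?normrN1 ?lexx ?andbT; lra.
  apply: le_trans (measureU2 _ _ _) _ => //.
  apply: leeD; apply: tail; rewrite ?normrN1 ?normr1//.
  by rewrite lexx/=; lra.
have QE : Q E \is a fin_num by exact: fin_num_measure.
move: QC; rewrite probability_setC// -(fineK QE) -EFinB !lee_fin /t; lra.
Qed.

(** * From the sample size to the confidence level *)

(** [48 = 3 * 16]: the 16 cancels the one in the tail exponent, so the exponent is at least [3 L].
    With [s = exp L] the failure probability is at most [3 / s^3], and [s >= 1 / delta] and [s >= 2]
    bring it below [delta]. *)
Lemma sample_size_suffices (R : realType) (a B delta e N : R) :
  0 < a -> 0 < B -> 0 < delta -> 0 < e ->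
  let L := ln (expR 1 + B + B^-1 + e^-1 + a^-1 + delta^-1) in
  48 * L `^ 48 * (B ^+ 2 / (a * e ^+ 2) + B / (a * e)) <= N ->
  3 * expR (- (N * (a * e ^+ 2 / (16 * B ^+ 2)))) <= delta.
Proof.
move=> a0 B0 de0 e0 L hN.
pose s := expR 1 + B + B^-1 + e^-1 + a^-1 + delta^-1.
have BV : 0 < B^-1 by rewrite invr_gt0.
have eV : 0 < e^-1 by rewrite invr_gt0.
have aV : 0 < a^-1 by rewrite invr_gt0.
have dV : 0 < delta^-1 by rewrite invr_gt0.
have e1 : 2 <= expR 1 :> R by apply: le_trans (expR_ge1Dx 1); lra.
have s0 : 0 < s by rewrite /s; lra.
have L1 : 1 <= L by rewrite -[leLHS](@expRK R) [leRHS]/(ln s) ler_ln ?posrE ?expR_gt0// /s; lra.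
(* The power of the logarithm dominates the logarithm because [L >= 1]. *)
have LL : L <= L `^ 48.
  by rewrite -[leLHS]powRr1 ?(le_trans _ L1)// ler_powR//; lra.
have aee : 0 < a * e ^+ 2 by rewrite mulr_gt0// exprn_gt0.
have BB : 0 < B ^+ 2 by rewrite exprn_gt0.
have NL : 3 * L <= N * (a * e ^+ 2 / (16 * B ^+ 2)).
  have -> : 3 * L = 48 * L * (B ^+ 2 / (a * e ^+ 2)) * (a * e ^+ 2 / (16 * B ^+ 2)).
    by field; rewrite !gt_eqF.
  rewrite ler_pM2r ?divr_gt0 ?mulr_gt0//; apply: le_trans hN.
  apply: ler_pM.
  - by rewrite mulr_ge0// (le_trans _ L1).
  - by rewrite divr_ge0 ?ltW.
  - by rewrite ler_pM2l.
  - by rewrite lerDl divr_ge0 ?mulr_ge0 ?ltW.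
apply: (@le_trans _ _ (3 * expR (- (3 * L)))).
  by rewrite ler_pM2l// ler_expR lerN2.
rewrite expRN expRM_natl [L]/(ln s) lnK ?posrE// ler_pdivrMr ?exprn_gt0//.
have ds : 1 <= delta * s.
  by rewrite -[leLHS](mulfV (x := delta)) ?gt_eqF// ler_pM2l// /s; lra.
have s2 : 2 <= s by rewrite /s; lra.
rewrite exprS mulrA.
have : 4 <= s ^+ 2 by rewrite expr2; nra.
have : 0 <= s ^+ 2 by exact: sqr_ge0.
move=> ? ?; nra.
Qed.

Theorem corollary4p6 (R : realType) :
  exists C : R, 0 < C /\
  forall (alpha B : R), 0 < alpha < 1 -> 0 < B ->
  forall (d : measure_display) (Omega : measurableType d)
    (P : probability Omega R) (X : Omega -> R),
    measurable_fun setT X -> (forall w, - B <= X w <= B) ->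
  forall (delta epsilon : R), 0 < delta < 1 -> 0 < epsilon <= B ->
  forall n : nat,
    let Lambda := ln (expR 1 + B + B^-1 + epsilon^-1 + alpha^-1 + delta^-1) in
    C * Lambda `^ C *
      (B ^+ 2 / (alpha * epsilon ^+ 2) + B / (alpha * epsilon)) <= n%:R ->
  forall (d' : measure_display) (Omega' : measurableType d')
    (Q : probability Omega' R) (S : 'I_n -> Omega' -> Omega),
    iid_samples Q P S ->
    holds_with_probability_ge Q (1 - delta)
      [set w | (`|cvar P alpha X - cvar (empirical R (fun i => S i w)) alpha X|
                  <= epsilon%:E)%E].
Proof.
exists 48; split=> // alpha B /andP[a0 a1] B0 d Omega P X mX XB delta e.
move=> /andP[de0 de1] /andP[e0 eB] n Lambda hn d' Omega' Q S iid.
have := sample_size_suffices a0 B0 de0 e0 hn.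
(* For [n = 0] the sample-size bound would read [3 <= delta], contradicting [delta < 1]. *)
case: n hn S iid => [|n] _ S iid hd; first by move: hd; rewrite mul0r oppr0 expR0; lra.
have eeB : 0 < e <= B by rewrite e0.
have [mE QE] := iid_cvar_close mX XB B0 a0 (ltW a1) eeB iid.
by split=> //; apply: le_trans QE; rewrite lee_fin lerD2l lerN2.
Qed.
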